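(* The fractal prime set $P_F\subset[0,1]$ (defined in the context) is non-empty, compact, nowhere dense, and has Lebesgue measure zero.
   Context: Let $p_n$ denote the $n$-th prime ($p_1=2,\ p_2=3,\ p_3=5,\dots$). For each $n\ge 1$ put $a_n = p_n \bmod 16\in\{0,\dots,15\}$ and $b_n=(a_n+8)\bmod 16\in\{0,\dots,15\}$. Define compact sets $F_n\subset[0,1]$ recursively. $F_0=[0,1]$. Given $F_{n-1}$ as a union of $2^{n-1}$ disjoint closed intervals $I_{n-1,k}=[x_k,\,x_k+16^{-(n-1)}]$ ($k=1,\dots,2^{n-1}$), divide each into 16 closed subintervals $I_{n-1,k}^{(j)}=[x_k+j\cdot16^{-n},\;x_k+(j+1)\cdot16^{-n}]$, $j=0,\dots,15$, and keep exactly those with indices $a_n$ and $b_n$: $F_n=\bigcup_{k=1}^{2^{n-1}}\bigl(I_{n-1,k}^{(a_n)}\cup I_{n-1,k}^{(b_n)}\bigr)$. The fractal prime set is $P_F=\bigcap_{n=0}^\infty F_n$. *)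

(* Defs.v *)
From mathcomp Require Import all_boot all_order all_algebra.
From mathcomp Require Import all_classical all_reals all_analysis.

Set Implicit Arguments.
Unset Strict Implicit.
Unset Printing Implicit Defensive.

Import Order.TTheory GRing.Theory Num.Theory.
Import numFieldNormedType.Exports.

Local Open Scope classical_set_scope.
Local Open Scope ring_scope.

Lemma ex_next_prime (m : nat) : exists p, (m < p)%N && prime p.
Proof. by have [p mp pp] := prime_above m; exists p; rewrite mp. Qed.

Definition next_prime (m : nat) : nat := ex_minn (ex_next_prime m).

(* Indexing starts at 1: [nth_prime 1 = 2], [nth_prime 2 = 3], and so on.
   The value [nth_prime 0 = 0] is never used. *)
Definition nth_prime (n : nat) : nat := iter n next_prime 0%N.

Definition digit_a (n : nat) : nat := (nth_prime n %% 16)%N.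

Definition digit_b (n : nat) : nat := ((digit_a n + 8) %% 16)%N.

(* The left endpoints [x_k] of the intervals [[x_k, x_k + 16^-n]] making up
   [F_set R n]. *)
Fixpoint left_ends (R : realType) (n : nat) : seq R :=
  if n is m.+1 then
    flatten [seq [:: x + (digit_a n)%:R * 16 ^- n; x + (digit_b n)%:R * 16 ^- n]
            | x <- left_ends R m]
  else [:: 0].

Definition F_set (R : realType) (n : nat) : set R :=
  \bigcup_(x in [set` left_ends R n]) `[x, x + 16 ^- n]%classic.

Arguments F_set : clear implicits.

Definition fractal_prime_set (R : realType) : set R :=
  \bigcap_n F_set R n.

Arguments fractal_prime_set : clear implicits.

Definition nowhere_dense (T : topologicalType) (A : set T) : Prop :=
  interior (closure A) = set0.

(* Main.v *)
Require Import Defs.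
From mathcomp Require Import all_boot all_order all_algebra.
From mathcomp Require Import all_classical all_reals all_analysis.
From mathcomp Require Import measurable_realfun lra.
Import Order.TTheory GRing.Theory Num.Theory.
Import numFieldNormedType.Exports.
Local Open Scope classical_set_scope.
Local Open Scope ring_scope.

(** The [n]-th approximation [F_set R n] is a union of [2 ^ n] closed intervals
of length [16 ^- n].  Being a finite union of closed intervals, it is closed,
and by subadditivity its measure is at most [2 ^ n / 16 ^ n = 8 ^- n].

The limit set lies in each approximation.  It is therefore closed, contained in
[F_set R 0 = `[0, 1]], hence compact, and its measure is at most [8 ^- n] for
every [n], hence zero ([lebesgue_measure_fractal_prime_set]).  A set of measure
zero contains no ball, so a closed one is nowhere dense
([lebesgue_null_interior]).

For non-emptiness ([fractal_prime_set_nonempty]), choosing the digit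
[digit_a n] at every stage selects one interval of each [F_set R n].  These
intervals are nested, since a digit [d < 16] satisfies
[d / 16 ^ n.+1 + 1 / 16 ^ n.+1 <= 1 / 16 ^ n], and so they have a common
point. *)

(** The supremum of the left endpoints is a common point: any left endpoint is
below any right endpoint, as the interval with the larger index shows. *)
Lemma nested_segments_meet (R : realType) (x y : nat -> R) :
  nondecreasing_seq x -> nonincreasing_seq y -> (forall n, x n <= y n) ->
  exists c, forall n, x n <= c <= y n.
Proof.
move=> x_incr y_decr le_xy.
have le_x_y m n : x m <= y n.
  apply: (le_trans (x_incr _ _ (leq_maxl m n))).
  exact: le_trans (le_xy _) (y_decr _ _ (leq_maxr m n)).
exists (sup (range x)) => n; apply/andP; split.
  by apply: ub_le_sup; [exists (y 0%N) => _ [m _ <-] | exists n].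
by apply: ge_sup; [exists (x 0%N), 0%N | move=> _ [m _ <-]].
Qed.

Lemma content_bigsetU_le (d : measure_display) (T : ringOfSetsType d)
    (R : realFieldType) (mu : {content set T -> \bar R}) (I : Type) (s : seq I)
    (F : I -> set T) :
  (forall i, measurable (F i)) ->
  (mu (\big[setU/set0]_(i <- s) F i) <= \sum_(i <- s) mu (F i))%E.
Proof.
move=> mF; elim: s => [|i s IHs]; first by rewrite !big_nil measure0.
rewrite !big_cons; apply: le_trans (leeD2l _ IHs).
by apply: measureU2 => //; exact: bigsetU_measurable.
Qed.

(** An interior point is the centre of a ball inside the set, and balls have
positive measure. *)
Lemma lebesgue_null_interior (R : realType) (A : set R) :
  measurable A -> lebesgue_measure A = 0%E -> interior A = set0.
Proof.
move=> mA A0; rewrite -subset0 => x /nbhs_ballP[e /= e0 xeA].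
have : (lebesgue_measure (ball x e) <= lebesgue_measure A)%E.
  by apply: le_measure; rewrite ?inE // ball_itv; exact: measurable_itv.
rewrite A0 lebesgue_measure_ball; last exact: ltW.
by rewrite lee_fin leNgt pmulrn_lgt0 // e0.
Qed.

Lemma size_left_ends (R : realType) n : size (left_ends R n) = (2 ^ n)%N.
Proof.
elim: n => //= n IHn; rewrite size_flatten /shape -map_comp expnSr -IHn.
by elim: (left_ends R n) => //= x s ->; rewrite mulSn.
Qed.

Lemma F_set_bigsetU (R : realType) n :
  F_set R n = \big[setU/set0]_(x <- left_ends R n) `[x, x + 16 ^- n]%classic.
Proof. exact: bigcup_seq. Qed.

Lemma closed_F_set (R : realType) n : closed (F_set R n).
Proof.
by rewrite F_set_bigsetU; apply: closed_bigsetU => x _; exact: interval_closed.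
Qed.

Lemma lebesgue_measure_F_set_le (R : realType) n :
  (lebesgue_measure (F_set R n) <= (8^-1 ^+ n)%:E)%E.
Proof.
rewrite F_set_bigsetU; apply: le_trans.
  by apply: content_bigsetU_le => x; exact: measurable_itv.
have len x : lebesgue_measure `[x, x + 16 ^- n : R]%classic = (16 ^- n)%:E.
  rewrite lebesgue_measure_itv /= lte_fin ltrDl invr_gt0 exprn_gt0//.
  by rewrite -EFinD addrAC subrr add0r.
rewrite (eq_bigr _ (fun x _ => len x)) sumEFin lee_fin big_const_seq count_predT.
rewrite iter_addr_0 size_left_ends -[leLHS]mulr_natl natrX -exprVn -exprMn.
by rewrite (_ : 2 * 16^-1 = 8^-1 :> R)//; lra.
Qed.

Lemma closed_fractal_prime_set (R : realType) : closed (fractal_prime_set R).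
Proof. by apply: closed_bigI => n _; exact: closed_F_set. Qed.

Lemma fractal_prime_set_sub01 (R : realType) :
  fractal_prime_set R `<=` `[0, 1]%classic.
Proof.
by move=> x /(_ 0%N I)[y /=]; rewrite inE => /eqP ->; rewrite expr0 invr1 add0r.
Qed.

Lemma fractal_prime_set_nonempty (R : realType) : fractal_prime_set R !=set0.
Proof.
pose x := fix x n : R :=
  if n is m.+1 then x m + (digit_a n)%:R * 16 ^- n else 0.
have x_left n : x n \in left_ends R n.
  elim: n => [|n IHn] /=; first by rewrite inE.
  apply/flattenP; eexists; first exact: (map_f _ IHn).
  by rewrite inE eqxx.
have e0 n : 0 <= 16 ^- n :> R by rewrite invr_ge0 exprn_ge0.
have [||n|c xc] := @nested_segments_meet R x (fun n => x n + 16 ^- n).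
- by apply/nondecreasing_seqP => n; rewrite lerDl mulr_ge0.
- apply/nonincreasing_seqP => n /=.
  (* Measured from [x n] in units of [16 ^- n.+1], the old right end is at 16
     and the new one at [digit_a n.+1 + 1]. *)
  have -> : 16 ^- n = 16 * 16 ^- n.+1 :> R.
    by rewrite exprS invfM mulrA divff ?mul1r// pnatr_eq0.
  have : (digit_a n.+1)%:R + 1 <= 16 :> R.
    by rewrite natr1 ler_nat ltn_mod.
  by move=> /(ler_wpM2r (e0 n.+1)); rewrite mulrDl mul1r -addrA lerD2l.
- by rewrite lerDl.
by exists c => n _; exists (x n); [exact: x_left | rewrite /= in_itv /= xc].
Qed.

Lemma lebesgue_measure_fractal_prime_set (R : realType) :
  lebesgue_measure (fractal_prime_set R) = 0%E.
Proof.
apply/eqP; rewrite -measure_le0; apply/lee_addgt0Pr => e e0; rewrite add0e.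
have : `|8^-1 : R| < 1 by rewrite ger0_norm; lra.
move=> /cvg_expr/cvgrPdist_lt/(_ e e0)[n _ /(_ n (leqnn n)) /= small].
have le_PF : (lebesgue_measure (fractal_prime_set R) <=
              lebesgue_measure (F_set R n))%E.
  apply: le_measure; rewrite ?inE; last exact: bigcap_inf.
  - by apply: closed_measurable; exact: closed_fractal_prime_set.
  - by apply: closed_measurable; exact: closed_F_set.
apply: (le_trans le_PF); apply: (le_trans (lebesgue_measure_F_set_le R n)).
rewrite lee_fin ltW//; apply: le_lt_trans small.
by rewrite sub0r normrN ler_norm.
Qed.

Theorem theorem7 (R : realType) :
  [/\ fractal_prime_set R `<=` `[0, 1]%classic,
      fractal_prime_set R !=set0,
      compact (fractal_prime_set R),
      nowhere_dense (fractal_prime_set R) &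
      lebesgue_measure (fractal_prime_set R) = 0%E].
Proof.
have P_closed := closed_fractal_prime_set R.
split.
- exact: fractal_prime_set_sub01.
- exact: fractal_prime_set_nonempty.
- apply: subclosed_compact P_closed _ (@fractal_prime_set_sub01 R).
  exact: segment_compact.
- rewrite /nowhere_dense -(closure_id _).1//.
  apply: lebesgue_null_interior; first exact: closed_measurable.
  exact: lebesgue_measure_fractal_prime_set.
- exact: lebesgue_measure_fractal_prime_set.
Qed.
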